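(* Let $\mathbb{T}$ be a time scale, unbounded above, with $0\in\mathbb{T}$ and graininess $\mu$. Let $z:\mathbb{T}\to\mathbb{R}$ be rd-continuous and delta differentiable, let $\lambda:\mathbb{T}\to\mathbb{R}$ be rd-continuous, and suppose that $z$ satisfies the inequality $z^{\Delta}(t)\le\lambda(t)z(t)$ with $z(0)=z_0\in\mathbb{R}$. If, for some $t_0\in\mathbb{T}$, $z(t)>0$ for all $t\in\mathbb{T}$ with $t\ge t_0$, then $\lambda\in\mathcal{R}^{+}$, i.e. $1+\mu(t)\lambda(t)>0$ for all $t\in\mathbb{T}$ with $t\ge t_0$.
   Context: A time scale $\mathbb{T}$ is a nonempty closed subset of $\mathbb{R}$. For $t\in\mathbb{T}$ the forward jump is $\sigma(t)=\inf\{s\in\mathbb{T}:s>t\}$ and the graininess is $\mu(t)=\sigma(t)-t\ge0$. The delta derivative $f^{\Delta}(t)$ is the (Hilger) derivative: $f^\Delta(t)=(f(\sigma(t))-f(t))/\mu(t)$ if $\mu(t)>0$, and $f^\Delta(t)=\lim_{s\to t,\,s\in\mathbb{T}}(f(t)-f(s))/(t-s)$ if $\mu(t)=0$. A function on $\mathbb{T}$ is rd-continuous if it is continuous at right-dense points ($\sigma(t)=t$) and has finite left-sided limits at left-dense points. $\mathcal{R}^{+}$ denotes the set of positively regressive functions, i.e. rd-continuous $\lambda$ with $1+\mu(t)\lambda(t)>0$ for all $t$ in the time scale under consideration. *)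

(* Defs.v *)
From mathcomp Require Import all_boot all_order all_algebra.
From mathcomp Require Import all_classical all_reals all_analysis.

Set Implicit Arguments.
Unset Strict Implicit.
Unset Printing Implicit Defensive.

Import Order.TTheory GRing.Theory Num.Theory.
Import numFieldNormedType.Exports.

Local Open Scope classical_set_scope.
Local Open Scope ring_scope.

(* A function on a time scale T is represented by a function R -> R; every
   notion below depends only on its values on T. *)

Definition time_scale (R : realType) (T : set R) : Prop :=
  T !=set0 /\ closed T.

Definition unbounded_above (R : realType) (T : set R) : Prop :=
  ~ has_ubound T.

(* At a maximum of T, [inf] is taken over the empty set and the value is
   meaningless; this does not occur when T is unbounded above. *)
Definition sigma (R : realType) (T : set R) (t : R) : R :=
  inf [set s | T s /\ t < s].

Definition graininess (R : realType) (T : set R) (t : R) : R :=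
  sigma T t - t.

Definition right_dense (R : realType) (T : set R) (t : R) : Prop :=
  sigma T t = t.

(* The nonemptiness condition says that t is not the minimum of T: the
   library's [sup set0] is 0, so the equation alone would not exclude it. *)
Definition left_dense (R : realType) (T : set R) (t : R) : Prop :=
  [set s | T s /\ s < t] !=set0 /\ sup [set s | T s /\ s < t] = t.

Definition rd_continuous (R : realType) (T : set R) (f : R -> R) : Prop :=
  (forall t, T t -> right_dense T t -> f s @[s --> within T (nbhs t)] --> f t)
  /\ (forall t, T t -> left_dense T t -> cvg (f s @[s --> within T t^'-])).

Definition delta_derivable (R : realType) (T : set R) (f : R -> R) (t : R) :
    Prop :=
  graininess T t = 0 ->
  cvg ((f t - f s) / (t - s) @[s --> within T t^']).

Definition delta_derive (R : realType) (T : set R) (f : R -> R) (t : R) : R :=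
  if 0 < graininess T t
  then (f (sigma T t) - f t) / graininess T t
  else lim ((f t - f s) / (t - s) @[s --> within T t^']).

Definition positively_regressive (R : realType) (T : set R) (lambda : R -> R) :
    Prop :=
  rd_continuous T lambda /\
  (forall t, T t -> 0 < 1 + graininess T t * lambda t).

(* Main.v *)
Require Import Defs.
From mathcomp Require Import all_boot all_order all_algebra.
From mathcomp Require Import all_classical all_reals all_analysis.
Import Order.TTheory GRing.Theory Num.Theory.
Import numFieldNormedType.Exports.
Local Open Scope classical_set_scope.
Local Open Scope ring_scope.

(** Only right-scattered points need an argument, since [1 + 0 * lambda t = 1].
    If [t] is right-scattered, then [sigma T t] is a point of [T] at or after
    [t0] ([sigma_in]: [T] is closed), so [z] is positive there. The delta
    derivative at [t] is the difference quotient over the jump, and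
    [z^Delta <= lambda z] rearranges to
    [0 < z (sigma T t) <= (1 + graininess T t * lambda t) * z t]; dividing by
    [z t > 0] gives the claim.

    Regressivity is asked on the truncated time scale of the points at or after
    [t0]. Truncating below leaves the forward jumps unchanged
    ([sigma_truncation]) and cannot destroy rd-continuity
    ([rd_continuous_truncation]). *)

Lemma unbounded_above_ex {R : realType} {T : set R} (t : R) :
  unbounded_above T -> [set s | T s /\ t < s] !=set0.
Proof.
apply: contra_notP => noT; exists t => s Ts.
by rewrite leNgt; apply/negP => ts; apply: noT; exists s.
Qed.

Lemma sigma_ge {R : realType} {T : set R} (t : R) :
  unbounded_above T -> t <= sigma T t.
Proof.
move=> Tub; apply: lb_le_inf => [|s [_ /ltW//]]; exact: unbounded_above_ex.
Qed.

(** The jump is an infimum of points of [T], hence a limit of such points;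
    unboundedness makes the set over which the infimum is taken nonempty. *)
Lemma sigma_in {R : realType} {T : set R} (t : R) :
  closed T -> unbounded_above T -> T (sigma T t).
Proof.
move=> Tcl Tub; apply: Tcl => B /nbhs_ballP[e /= e0 eB].
have hasinf : has_inf [set s | T s /\ t < s].
  by split; [exact: unbounded_above_ex|exists t => s [_ /ltW]].
have [s [Ts ts] sinf] := inf_adherent e0 hasinf.
exists s; split => //; apply: eB; rewrite /ball/= distrC.
have sge : sigma T t <= s by apply: ge_inf => //; exact: hasinf.2.
by rewrite ger0_norm ?subr_ge0// ltrBlDl.
Qed.

Lemma sigma_truncation {R : realType} {T : set R} {t0 t : R} :
  t0 <= t -> sigma (T `&` [set s | t0 <= s]) t = sigma T t.
Proof.
move=> t0t; congr inf; apply/seteqP; split=> s /=; first by move=> [[]].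
by move=> [Ts ts]; rewrite (le_trans t0t (ltW ts)).
Qed.

(** Adding points below [t] cannot move a supremum that already equals [t]. *)
Lemma left_dense_subset {R : realType} {A B : set R} {t : R} :
  A `<=` B -> left_dense A t -> left_dense B t.
Proof.
move=> AB [[s [As st]] supA].
have nonempty : [set s | B s /\ s < t] !=set0 by exists s; split => //; exact: AB.
split => //; apply/eqP; rewrite eq_le; apply/andP; split.
  by apply: ge_sup => // x [_ /ltW].
rewrite -{1}supA; apply: ge_sup; first by exists s.
move=> x [Ax xt]; apply: ub_le_sup; first by exists t => y [_ /ltW].
by split => //; exact: AB.
Qed.

Lemma cvg_within_subset {T : Type} {A B : set T} (F : set_system T) :
  Filter F -> A `<=` B -> within A F --> within B F.
Proof.
move=> FF AB P BP; rewrite /nbhs/= /within/=.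
by apply: (@filterS _ F FF _ _ _ BP) => x xP /AB /xP.
Qed.

(** A point of the truncation that is dense on one side there is dense on that
    side in [T], and limits along [T] persist along a subset. *)
Lemma rd_continuous_truncation {R : realType} {T : set R} {f : R -> R}
    (t0 : R) :
  rd_continuous T f -> rd_continuous (T `&` [set s | t0 <= s]) f.
Proof.
have sub : T `&` [set s | t0 <= s] `<=` T by move=> s [].
move=> [fr fl]; split=> t [Tt t0t].
  rewrite /right_dense sigma_truncation// => /(fr _ Tt).
  by apply: cvg_trans; apply: cvg_app; exact: cvg_within_subset.
move=> /(left_dense_subset sub) /(fl _ Tt) /cvg_ex[l fl_t]; apply/cvg_ex; exists l.
by apply: cvg_trans fl_t; apply: cvg_app; exact: cvg_within_subset.
Qed.

(** At a positive graininess the inequality on the delta derivative is the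
    one-step bound [z (sigma T t) <= (1 + graininess T t * lambda t) * z t], so
    the factor multiplying [z t] is at least the quotient of two positive values. *)
Lemma regressive_of_positive_jump {R : realType} {T : set R}
    {z lambda : R -> R} {t : R} :
  0 <= graininess T t -> delta_derive T z t <= lambda t * z t ->
  0 < z t -> 0 < z (sigma T t) -> 0 < 1 + graininess T t * lambda t.
Proof.
rewrite /delta_derive le_eqVlt => /predU1P[<- _ _ _|mu0].
  by rewrite mul0r addr0.
rewrite mu0 ler_pdivrMr// lerBlDr => zle zt zs.
rewrite -(pmulr_lgt0 _ zt); apply: (lt_le_trans zs); apply: (le_trans zle).
by rewrite mulrDl mul1r addrC mulrC mulrA.
Qed.

Theorem lemma4p3 (R : realType) (T : set R) (z lambda : R -> R) (z0 t0 : R)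
  (hT : time_scale T) (hTub : unbounded_above T) (hT0 : T 0)
  (hz_rd : rd_continuous T z)
  (hz_diff : forall t, T t -> delta_derivable T z t)
  (hlambda_rd : rd_continuous T lambda)
  (hz_ineq : forall t, T t -> delta_derive T z t <= lambda t * z t)
  (hz0 : z 0 = z0)
  (ht0 : T t0)
  (hz_pos : forall t, T t -> t0 <= t -> 0 < z t) :
  positively_regressive (T `&` [set t | t0 <= t]) lambda /\
  (forall t, T t -> t0 <= t -> 0 < 1 + graininess T t * lambda t).
Proof.
have regressive t : T t -> t0 <= t -> 0 < 1 + graininess T t * lambda t.
  move=> Tt t0t; have t_le_sigma := sigma_ge t hTub.
  apply: (@regressive_of_positive_jump _ _ z).
  - by rewrite subr_ge0.
  - exact: hz_ineq.
  - exact: hz_pos.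
  - by apply: hz_pos; [exact: sigma_in hT.2 hTub|exact: le_trans t_le_sigma].
split=> //; split; first exact: rd_continuous_truncation.
by move=> t [Tt t0t]; rewrite /graininess sigma_truncation//; exact: regressive.
Qed.
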